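(* Let $H$ be a Hilbert space, $U\subset H$ a closed linear subspace, $W\subset H$ a closed affine subspace with direction subspace $V$, and $u^{(0)}\in U$. Assume that $\theta_{\mathrm f}=\theta_{\mathrm f}(U,V)>0$. Let $(\alpha_n)_{n\ge0}$ be a real sequence, let $(u^{(n)})_{n\ge0}$ be defined by $$u^{(n+1)}=P_UP_W^{\alpha_n}u^{(n)},\qquad n\ge0,$$ and let $e^{(n)}:=u^{(n)}-P_{M_{U,W}}u^{(0)}$ for all $n\ge0$. Put $\lambda_n:=\frac{\sin^2\theta_p}{2}\alpha_n$. (i) If $\lambda_n\in[0,1]$ for all $n\ge0$ and $\liminf_{n\to\infty}\frac1n\sum_{j=0}^{n-1}\min(\lambda_j,1-\lambda_j)>0$, then $e^{(n)}$ converges linearly to zero. (ii) If moreover, for some $\epsilon\in(0,1]$, $\lambda_n\in[\frac\epsilon2,1-\frac\epsilon2]$ for all $n\ge0$, then $$\|e^{(n)}\|\le(1-\epsilon/\kappa^2)^n\,\|e^{(0)}\|,\quad n\ge0,\qquad\text{where }\kappa:=\sin\theta_p/\sin\theta_{\mathrm f}.$$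
   Context: $P_S$ denotes the orthogonal projection onto a nonempty closed affine subspace $S$ of $H$. For $\alpha\in\mathbb R$ and $u\in H$, $P_W^\alpha u:=u+\alpha(P_Wu-u)$. $M_{U,W}:=\{u\in U:\|u-P_Wu\|=\inf_{v\in U}\|v-P_Wv\|\}$, which is nonempty when $\theta_{\mathrm f}(U,V)>0$. The angle $\theta_p=\theta_p(U,V)\in[0,\pi/2]$ is $\theta_p:=\arcsin\|P_UP_{V^\perp}\|$. The Friedrichs angle $\theta_{\mathrm f}=\theta_{\mathrm f}(U,V)\in[0,\pi/2]$ is defined by $\cos\theta_{\mathrm f}:=\sup\{|\langle u,v\rangle|:u\in U_0,\ v\in V_0,\ \|u\|=\|v\|=1\}$, where $U_0:=U\cap(U\cap V)^\perp$ and $V_0:=V\cap(U\cap V)^\perp$ (the supremum of the empty set being $0$). ''Converges linearly to zero'' means that there are $C\ge0$ and $q\in(0,1)$ with $\|e^{(n)}\|\le Cq^n$ for all $n\ge0$. *)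

(* Defs.v *)
From HB Require Import structures.
From mathcomp Require Import all_boot all_order all_algebra.
From mathcomp Require Import complex.
From mathcomp Require Import boolp classical_sets functions reals ereal.
From mathcomp Require Import topology normedtype sequences trigo.

Set Implicit Arguments.
Unset Strict Implicit.
Unset Printing Implicit Defensive.

Import Order.TTheory GRing.Theory Num.Theory.
Import numFieldNormedType.Exports.

Local Open Scope classical_set_scope.
Local Open Scope ring_scope.

(* Hilbert spaces are taken over the reals or over the complex numbers
   [R[i]]; [scalar_kind] selects which. *)
Variant scalar_kind := Real | Complex.

Definition scalar_field (R : realType) (k : scalar_kind) : numFieldType :=
  match k with Real => R | Complex => R[i] end.

Definition scalar_re (R : realType) (k : scalar_kind) : scalar_field R k -> R :=
  match k with Real => fun x => x | Complex => @complex.Re R end.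

Definition scalar_conj (R : realType) (k : scalar_kind) : scalar_field R k -> scalar_field R k :=
  match k with Real => fun x => x | Complex => @conjc R end.

Definition scalar_of_real (R : realType) (k : scalar_kind) : R -> scalar_field R k :=
  match k with Real => fun x => x | Complex => @real_complex R end.

(* A Hilbert space is a complete normed module [H] together with
   [dot : {dot H for @scalar_conj R k}] (linear in its first argument) satisfying
   [hilbert_norm dot]. *)
Definition hilbert_norm (R : realType) (k : scalar_kind)
    (H : completeNormedModType (scalar_field R k)) (dot : {dot H for @scalar_conj R k}) :=
  forall u : H, dot u u = `|u| ^+ 2.

Section Hilbert.
Context {R : realType} {k : scalar_kind}
  {H : completeNormedModType (scalar_field R k)}.
Implicit Types (u v w : H) (S U V W : set H).

(* The library norms on [H] and on the scalars take their values in the scalar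
   field; these are the same numbers in [R]. *)
Definition rnorm u : R := scalar_re `|u|.
Definition modulus (z : scalar_field R k) : R := scalar_re `|z|.

Definition closed_subspace U := closed U /\ submod_closed [in U].

Definition closed_affine_subspace W V :=
  [/\ closed W, submod_closed [in V] & exists w, W = [set w + v | v in V]].

Definition opnorm (f : H -> H) : R :=
  sup [set rnorm (f u) | u in [set v | rnorm v <= 1]].

Definition converges_linearly_to_zero (e : nat -> H) :=
  exists C q : R, [/\ 0 <= C, 0 < q < 1 & forall n, rnorm (e n) <= C * q ^+ n].

Variable dot : {dot H for @scalar_conj R k}.

Definition orth S : set H := [set u | forall s, S s -> dot u s = 0].

(* On a Hilbert space, with [S] nonempty, closed and affine, such a [p] exists
   and is unique; the default value [0] of [xget] then plays no role. *)
Definition proj S u : H :=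
  xget 0 [set p | S p /\ forall s, S s -> dot (u - p) (s - p) = 0].

Definition relaxed_proj W (a : R) u : H := u + scalar_of_real k a *: (proj W u - u).

Definition min_gap_set U W : set H :=
  [set u | U u /\
     rnorm (u - proj W u) = inf [set rnorm (v - proj W v) | v in U]].

Definition theta_p U V : R := asin (opnorm (proj U \o proj (orth V))).

Definition friedrichs_part U V : set H := U `&` orth (U `&` V).

(* [sup set0 = 0] in the library, and the supremum always lies in [0, 1]. *)
Definition theta_f U V : R :=
  acos (sup [set c : R | exists u v,
    [/\ friedrichs_part U V u, friedrichs_part V U v, rnorm u = 1, rnorm v = 1
      & c = modulus (dot u v)]]).

End Hilbert.

(* Main.v *)
(* Write P for the projection onto U, Q for the projection onto the orthogonal
   complement of V, and T = P Q restricted to U. A positive Friedrichs angle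
   makes U + V closed, so a point w of W decomposes as m + v + r with m in U,
   v in V and r orthogonal to both. Then m is a point of M_{U,W}, which is
   m + (U n V), and the error obeys e_{n+1} = (1 - alpha_n T) e_n inside
   U0 = U n (U n V)^perp. On U0 the quadratic form <T e, e> = |Q e|^2 lies
   between sin^2(theta_f) |e|^2 and sin^2(theta_p) |e|^2, and T is
   self-adjoint, so 1 - alpha_n T has norm at most
   1 - 2 min(lambda_n, 1 - lambda_n) / kappa^2. This gives (ii) directly, and
   (i) through 1 - x <= exp (- x). The scalar product enters only through its
   real part, which treats real and complex scalars uniformly. *)

Require Import Defs.
From HB Require Import structures.
From mathcomp Require Import all_boot all_order all_algebra.
From mathcomp Require Import complex.
From mathcomp Require Import ring lra.
From mathcomp Require Import boolp classical_sets functions reals ereal.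
From mathcomp Require Import topology normedtype sequences trigo exp.

Set Implicit Arguments.
Unset Strict Implicit.
Unset Printing Implicit Defensive.

Import Order.TTheory GRing.Theory Num.Theory.
Import numFieldNormedType.Exports.

Local Open Scope classical_set_scope.
Local Open Scope ring_scope.

Lemma subrACA (V : zmodType) (x y z t : V) :
  x - y - (z - t) = x - z - (y - t).
Proof. by rewrite !opprB addrACA (addrC (- y)) -addrACA. Qed.

(** * Real and complex scalars treated alike through real parts and moduli *)

Section Scalars.
Context {R : realType} {k : scalar_kind}.
Implicit Types (a b : R) (z : scalar_field R k).

Lemma scalar_reD : {morph @scalar_re R k : z z' / z + z'}.
Proof. by case: k => //= -[a b] [c d]. Qed.

Lemma scalar_reZ a z : scalar_re (scalar_of_real k a * z) = a * scalar_re z.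
Proof. by case: k z => //= -[c d] /=; rewrite mul0r subr0. Qed.

Lemma scalar_re_conj z : scalar_re (scalar_conj z) = scalar_re z.
Proof. by case: k z => //= -[]. Qed.

Lemma scalar_ofK a : @scalar_re R k (scalar_of_real k a) = a.
Proof. by case: k. Qed.

Lemma scalar_ofM : {morph @scalar_of_real R k : a b / a * b}.
Proof. by case: k => //= a b; rewrite rmorphM. Qed.

Lemma scalar_ofN : {morph @scalar_of_real R k : a / - a}.
Proof. by case: k => //= a; rewrite rmorphN. Qed.

Lemma scalar_of1 : @scalar_of_real R k 1 = 1.
Proof. by case: k. Qed.

Lemma scalar_of0 : @scalar_of_real R k 0 = 0.
Proof. by case: k. Qed.

Lemma scalar_re0 : @scalar_re R k 0 = 0.
Proof. by case: k. Qed.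

Lemma scalar_of_lt a b : (scalar_of_real k a < scalar_of_real k b) = (a < b).
Proof. by case: k => //=; rewrite ltcR. Qed.

(** In the order of [R[i]], being comparable with zero forces a vanishing imaginary part. This is
    what lets scalar-valued norms be read as real numbers. *)
Lemma scalar_of_ge0 z : 0 <= z -> z = scalar_of_real k (scalar_re z).
Proof. by case: k z => //= -[a b]; rewrite lecE /= => /andP[/eqP ->]. Qed.

Lemma scalar_re_ge0 z : 0 <= z -> 0 <= scalar_re z.
Proof. by case: k z => //= -[a b]; rewrite lecE /= => /andP[]. Qed.

Lemma scalar_re_le z z' : z <= z' -> scalar_re z <= scalar_re z'.
Proof. by case: k z z' => //= -[a b] [c d]; rewrite lecE /= => /andP[]. Qed.

Lemma modulusE z : `|z| = scalar_of_real k (modulus z).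
Proof. exact/scalar_of_ge0/normr_ge0. Qed.

Lemma scalar_conjMr z :
  scalar_conj z * z = scalar_of_real k (modulus z ^+ 2).
Proof.
rewrite expr2 scalar_ofM -modulusE -expr2; case: k z => [z|z] /=.
  by rewrite -expr2 real_normK // num_real.
by rewrite mulrC; exact/esym/sqr_normc.
Qed.

Lemma scalar_re_modulus z : scalar_re z <= modulus z.
Proof.
case: k z => [z|z]; rewrite /modulus /=; first exact: ler_norm.
rewrite (le_trans (ler_norm _)) //.
by have := normc_ge_Re z; rewrite lecE => /andP[].
Qed.

Lemma modulus_ge0 z : 0 <= modulus z.
Proof. exact/scalar_re_ge0/normr_ge0. Qed.

Lemma modulus_conj z : modulus (scalar_conj z) = modulus z.
Proof. by case: k z => // z; congr (scalar_re _); exact: normcJ. Qed.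

Lemma modulus_real a : modulus (scalar_of_real k a) = `|a|.
Proof.
by case: k => //; rewrite /modulus /= expr0n /= addr0 sqrtr_sqr.
Qed.

Lemma modulus0_eq0 z : modulus z = 0 -> z = 0.
Proof.
move=> h; apply/eqP; rewrite -normr_eq0; apply/eqP.
by rewrite modulusE h scalar_of0.
Qed.
End Scalars.

(** * The real inner product underlying [dot] *)

Section InnerProduct.
Context {R : realType} {k : scalar_kind}
  {H : completeNormedModType (scalar_field R k)}
  {dot : {dot H for @scalar_conj R k}}.
Hypothesis hdot : hilbert_norm dot.
Implicit Types (u v w : H) (a b : R) (z : scalar_field R k) (S : set H).

Local Notation "a *r u" := (scalar_of_real k a *: u) (at level 40).

Definition real_dot u v : R := scalar_re (dot u v).
Local Notation rdot := real_dot.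

Lemma dotC u v : dot u v = scalar_conj (dot v u).
Proof. by rewrite (@hermitian_subproof _ _ _ _ dot) expr0 mul1r. Qed.

Lemma rdotC u v : rdot u v = rdot v u.
Proof. by rewrite /real_dot dotC scalar_re_conj. Qed.

Lemma rdotDl u v w : rdot (u + v) w = rdot u w + rdot v w.
Proof. by rewrite /real_dot linearDl scalar_reD. Qed.

Lemma rdotZl a u v : rdot (a *r u) v = a * rdot u v.
Proof. by rewrite /real_dot linearZl_LR scalar_reZ. Qed.

Lemma rdotDr u v w : rdot u (v + w) = rdot u v + rdot u w.
Proof. by rewrite rdotC rdotDl !(rdotC u). Qed.

Lemma rdotZr a u v : rdot u (a *r v) = a * rdot u v.
Proof. by rewrite rdotC rdotZl rdotC. Qed.

Lemma rdotNl u v : rdot (- u) v = - rdot u v.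
Proof. by rewrite -scaleN1r -(@scalar_of1 R) -scalar_ofN rdotZl mulN1r. Qed.

Lemma rdotNr u v : rdot u (- v) = - rdot u v.
Proof. by rewrite rdotC rdotNl rdotC. Qed.

Lemma rdotBl u v w : rdot (u - v) w = rdot u w - rdot v w.
Proof. by rewrite rdotDl rdotNl. Qed.

Lemma rdotBr u v w : rdot u (v - w) = rdot u v - rdot u w.
Proof. by rewrite rdotDr rdotNr. Qed.

Lemma rdot0l u : rdot 0 u = 0.
Proof. by rewrite -(subrr 0) rdotBl subrr. Qed.

Lemma rdot0r u : rdot u 0 = 0.
Proof. by rewrite rdotC rdot0l. Qed.

Lemma rnorm_ge0 u : 0 <= rnorm u.
Proof. exact/scalar_re_ge0/normr_ge0. Qed.

Lemma normE u : `|u| = scalar_of_real k (rnorm u).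
Proof. exact/scalar_of_ge0/normr_ge0. Qed.

Lemma rdotE u : rdot u u = rnorm u ^+ 2.
Proof. by rewrite /real_dot hdot normE expr2 -scalar_ofM scalar_ofK expr2. Qed.

Lemma rnorm_eq0 u : rnorm u = 0 -> u = 0.
Proof. by move=> u0; apply/eqP; rewrite -normr_eq0 normE u0 scalar_of0. Qed.

Lemma rdot_eq0 u : rdot u u = 0 -> u = 0.
Proof. by rewrite rdotE => /eqP; rewrite sqrf_eq0 => /eqP/rnorm_eq0. Qed.

Lemma rnormZ z u : rnorm (z *: u) = modulus z * rnorm u.
Proof.
rewrite {1}/rnorm normrZ normE modulusE.
by rewrite -scalar_ofM scalar_ofK.
Qed.

Lemma rnormD u v : rnorm (u + v) <= rnorm u + rnorm v.
Proof. by rewrite /rnorm -scalar_reD scalar_re_le // ler_normD. Qed.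

Lemma rnormN u : rnorm (- u) = rnorm u.
Proof. by rewrite /rnorm normrN. Qed.

Lemma rnorm_distC u v : rnorm (u - v) = rnorm (v - u).
Proof. by rewrite -rnormN opprB. Qed.

Lemma rnorm0 : rnorm (0 : H) = 0.
Proof. by rewrite /rnorm normr0 scalar_re0. Qed.

Lemma cauchy_schwarz u v : rdot u v <= rnorm u * rnorm v.
Proof.
(* With [a], [b] the norms and [d] the real inner product, this square expands to
   [2 * a * b * (a * b - d)]; dividing by [a * b] leaves the claim. *)
have := sqr_ge0 (rnorm (rnorm v *r u - rnorm u *r v)).
rewrite -rdotE !(rdotBl, rdotBr, rdotZl, rdotZr) !rdotE (rdotC v u).
set a := rnorm u; set b := rnorm v; set d := rdot u v => h.
have a0 : 0 <= a by exact: rnorm_ge0.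
have b0 : 0 <= b by exact: rnorm_ge0.
have [ab0|ab0] := eqVneq (a * b) 0.
  suff -> : d = 0 by rewrite ab0.
  by move/eqP: ab0; rewrite mulf_eq0 => /orP[]/eqP/rnorm_eq0; rewrite /d => ->;
    rewrite ?rdot0l ?rdot0r.
have {}ab0 : 0 < a * b by rewrite lt_def ab0 mulr_ge0.
by rewrite -subr_ge0 -(pmulr_rge0 _ ab0); nra.
Qed.

(** Rotating [u] by the conjugate of [z = dot u v] makes the inner product the real number
    [modulus z ^+ 2], so the real inequality applies; one factor [modulus z] then cancels. *)
Lemma modulus_dot_le u v : modulus (dot u v) <= rnorm u * rnorm v.
Proof.
set z := dot u v.
have [->|z0] := eqVneq (modulus z) 0; first by rewrite mulr_ge0 ?rnorm_ge0.
have {}z0 : 0 < modulus z by rewrite lt_def z0 modulus_ge0.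
have := cauchy_schwarz (scalar_conj z *: u) v.
rewrite /real_dot linearZl_LR scalar_conjMr scalar_ofK.
by rewrite rnormZ modulus_conj expr2 -mulrA ler_pM2l.
Qed.
End InnerProduct.

(** * Orthogonal projections *)

Section Projection.
Context {R : realType} {k : scalar_kind}
  {H : completeNormedModType (scalar_field R k)}
  {dot : {dot H for @scalar_conj R k}}.
Hypothesis hdot : hilbert_norm dot.
Implicit Types (u v w p s : H) (a b : R) (z : scalar_field R k) (S : set H).

Local Notation "a *r u" := (scalar_of_real k a *: u) (at level 40).
Local Notation rdot := (@real_dot _ _ _ dot).
Local Notation proj := (proj dot).

Definition submod S := S 0 /\ forall z u v, S u -> S v -> S (z *: u + v).

Lemma submodP S : submod_closed [in S] -> submod S.
Proof.
move=> [S0 Slin]; split=> [|z u v Su Sv]; first exact/set_mem.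
by apply/set_mem/Slin; exact/mem_set.
Qed.

Lemma submodD S u v : submod S -> S u -> S v -> S (u + v).
Proof. by move=> [_ Sl] Su Sv; rewrite -(scale1r u); exact: Sl. Qed.

Lemma submodZ S z u : submod S -> S u -> S (z *: u).
Proof. by move=> [S0 Sl] Su; rewrite -(addr0 (_ *: _)); exact: Sl. Qed.

Lemma submodN S u : submod S -> S u -> S (- u).
Proof. by move=> Ss Su; rewrite -scaleN1r; exact: submodZ. Qed.

Lemma submodB S u v : submod S -> S u -> S v -> S (u - v).
Proof. by move=> Ss Su Sv; apply: submodD => //; exact: submodN. Qed.

Lemma submodI S S' : submod S -> submod S' -> submod (S `&` S').
Proof.
move=> [S0 Sl] [S'0 S'l]; split=> // z u v [Su S'u] [Sv S'v].
by split; [exact: Sl|exact: S'l].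
Qed.

Lemma orth_submod S : submod (orth dot S).
Proof.
split=> [s _|z u v Su Sv s Ss]; first by rewrite linear0l.
have /= -> := linearDl dot s (z *: u) v; have /= -> := linearZl_LR dot s z u.
by rewrite Su // Sv // addr0 mulr0.
Qed.

Lemma orth_rdot S u s : orth dot S u -> S s -> rdot u s = 0.
Proof. by move=> Su Ss; rewrite /real_dot Su // scalar_re0. Qed.

(* Testing against [dot u s *: s] recovers the vanishing of [dot u s] from
   that of its real part. *)
Lemma rdot_orth S u : submod S ->
  (forall s, S s -> rdot u s = 0) -> orth dot S u.
Proof.
move=> Ss h s /(submodZ (dot u s) Ss)/h.
rewrite rdotC /real_dot; have /= -> := linearZl_LR dot u (dot u s) s.
rewrite (dotC s u).
rewrite mulrC scalar_conjMr scalar_ofK => /eqP; rewrite sqrf_eq0 => /eqP.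
exact: modulus0_eq0.
Qed.

(** * Sequential completeness with respect to the real-valued norm *)

Definition rcauchy (x : nat -> H) := forall e : R, 0 < e ->
  exists N, forall m n, (N <= m)%N -> (N <= n)%N -> rnorm (x m - x n) < e.

Definition rcvg (x : nat -> H) l := forall e : R, 0 < e ->
  exists N, forall n, (N <= n)%N -> rnorm (x n - l) < e.

(** The working form of closedness: minimizing sequences use it directly, and it passes to
    intersections, to the direction of a closed affine subspace and to the sum of [U0] and [V]. *)
Definition rcomplete S := forall x : nat -> H, (forall n, S (x n)) ->
  rcauchy x -> exists2 l, S l & rcvg x l.

Lemma rcauchy_cvg x : rcauchy x -> cvgn x.
Proof.
move=> xc; apply/cauchy_cvgP/cauchy_exP => e e0.
have := e0.
rewrite (scalar_of_ge0 (ltW e0)) -(@scalar_of0 R) scalar_of_lt => e0'.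
have [N hN] := xc _ e0'; exists (x N); exists N => // n Nn.
by rewrite -ball_normE /ball_ /= (normE (x N - x n)) scalar_of_lt; exact: hN.
Qed.

Lemma cvgn_rcvg x l : (x @ \oo --> l) -> rcvg x l.
Proof.
move=> xl e e0.
have e0' : 0 < scalar_of_real k e by rewrite -(@scalar_of0 R) scalar_of_lt.
have /cvgrPdist_lt/(_ _ e0')[N _ hN] := xl.
exists N => n Nn; rewrite -(@scalar_of_lt R k) -normE distrC; exact: hN.
Qed.

Lemma closed_rcomplete S : closed S -> rcomplete S.
Proof.
move=> Sc x xS /rcauchy_cvg xc; exists (limn x); last exact: cvgn_rcvg.
by apply: (closed_cvg _ _ _ _ xc) => //; exact: nearW.
Qed.

Lemma rcauchyB x y : rcauchy x -> rcauchy y -> rcauchy (fun n => x n - y n).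
Proof.
move=> xc yc e e0; have e2 : 0 < e / 2 by lra.
have [N hN] := xc _ e2; have [N' hN'] := yc _ e2.
exists (maxn N N') => m n; rewrite !geq_max => /andP[Nm N'm] /andP[Nn N'n].
have := hN _ _ Nm Nn; have := hN' _ _ N'm N'n.
have := rnormD (x m - x n) (- (y m - y n)).
by rewrite subrACA rnormN; lra.
Qed.

Lemma rcvgD x y (a b : H) : rcvg x a -> rcvg y b ->
  rcvg (fun n => x n + y n) (a + b).
Proof.
move=> xa yb e e0; have e2 : 0 < e / 2 by lra.
have [N hN] := xa _ e2; have [N' hN'] := yb _ e2.
exists (maxn N N') => n; rewrite geq_max => /andP[Nn N'n].
have := hN _ Nn; have := hN' _ N'n; have := rnormD (x n - a) (y n - b).
by rewrite addrACA -opprD; lra.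
Qed.

Lemma rcvg_uniq x (a b : H) : rcvg x a -> rcvg x b -> a = b.
Proof.
move=> xa xb; apply/eqP; rewrite -subr_eq0; apply/eqP/rnorm_eq0/le_anti.
rewrite rnorm_ge0 andbT; apply/ler_addgt0Pl => e e0; rewrite addr0.
have e2 : 0 < e / 2 by lra.
have [N hN] := xa _ e2; have [N' hN'] := xb _ e2.
have := hN _ (leq_maxl N N'); have := hN' _ (leq_maxr N N').
set y := x _; have := rnormD (a - y) (y - b).
by rewrite addrA subrK (rnorm_distC a); lra.
Qed.

Lemma rcompleteI S S' : rcomplete S -> rcomplete S' -> rcomplete (S `&` S').
Proof.
move=> Sc S'c x xSS' xc.
have [l Sl xl] := Sc x (fun n => (xSS' n).1) xc.
have [l' S'l xl'] := S'c x (fun n => (xSS' n).2) xc.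
by exists l => //; split=> //; rewrite (rcvg_uniq xl xl').
Qed.

(** Orthogonality survives the limit because [dot l s = dot (l - x n) s], which Cauchy-Schwarz makes
    arbitrarily small. *)
Lemma rcompleteI_orth S S' : rcomplete S -> rcomplete (S `&` orth dot S').
Proof.
move=> Sc x xS xc; have [l Sl xl] := Sc x (fun n => (xS n).1) xc.
exists l => //; split=> // s S's.
apply/modulus0_eq0/le_anti; rewrite modulus_ge0 andbT.
apply/ler_addgt0Pl => e e0; rewrite addr0.
(* Adding 1 keeps the divisor positive when [s = 0]. *)
have s0 : 0 < rnorm s + 1 by have := rnorm_ge0 s; lra.
have [N /(_ N (leqnn N))] := xl _ (divr_gt0 e0 s0).
rewrite ltr_pdivlMr // => xle.
have -> : dot l s = dot (l - x N) s.
  have /= -> := linearBl dot s l (x N).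
  by rewrite ((xS N).2 s S's) subr0.
have := modulus_dot_le hdot (l - x N) s; rewrite rnorm_distC.
by have := rnorm_ge0 (x N - l); nra.
Qed.

Lemma rcomplete_affine w V : closed [set w + v | v in V] -> rcomplete V.
Proof.
move=> Wc x xV xc.
have [|e e0|_ [v Vv <-] xl] := closed_rcomplete Wc (x := fun n => w + x n).
- by move=> n; exists (x n).
- have [N hN] := xc e e0; exists N => m n Nm Nn.
  by rewrite opprD addrACA subrr add0r; exact: hN.
exists v => // e e0; have [N hN] := xl e e0; exists N => n Nn.
by have := hN n Nn; rewrite opprD addrACA subrr add0r.
Qed.

Lemma best_approximation S u : submod S -> rcomplete S ->
  exists2 p, S p & forall s, S s -> rnorm (u - p) <= rnorm (u - s).
Proof.
move=> Ss Sc.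
pose A := [set rnorm (u - s) ^+ 2 | s in S]; pose d := inf A.
have hA : has_inf A.
  split; first by exists (rnorm (u - 0) ^+ 2); exists 0 => //; case: Ss.
  by exists 0 => _ [s _ <-]; exact: sqr_ge0.
have dle s : S s -> d <= rnorm (u - s) ^+ 2.
  by move=> ?; apply: ge_inf; [case: hA|exists s].
(* A minimizing sequence for the squared distance, with explicit rate. *)
have /choice[x hx] n : exists s, S s /\ rnorm (u - s) ^+ 2 < d + n.+1%:R^-1.
  have n0 : (0 : R) < n.+1%:R^-1 by rewrite invr_gt0.
  by have [_ [s Ss' <-] sd] := inf_adherent n0 hA; exists s.
have invN (e : R) : 0 < e ->
    exists N, forall n, (N <= n)%N -> n.+1%:R^-1 < e.
  move=> e0; have [N hN] := ltr_add_invr (e0 : 0 < e); exists N => n Nn.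
  rewrite add0r in hN; apply: le_lt_trans hN.
  by rewrite lef_pV2 ?posrE ?ltr0Sn // ler_nat.
have xcauchy : rcauchy x.
  (* By the parallelogram law at the midpoint, the squared distance of [x m] and [x n] is less than
     twice the sum of their two excesses over [d]; excesses below [e ^+ 2 / 4] therefore suffice. *)
  move=> e e0; have [|N hN] := invN (e ^+ 2 / 4); first by nra.
  exists N => m n Nm Nn; rewrite -(@ltr_pXn2r _ 2) ?nnegrE ?rnorm_ge0 ?(ltW e0) //.
  have mid : S (2^-1 *r (x m + x n)).
    by apply: submodZ => //; apply: submodD => //; case: (hx m); case: (hx n).
  have /dle := mid; have [_] := hx m; have [_] := hx n.
  have := hN _ Nm; have := hN _ Nn.
  rewrite -!(rdotE hdot) !(rdotBl, rdotBr, rdotZl, rdotZr, rdotDl, rdotDr).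
  rewrite !(rdotC _ u) (rdotC (x n) (x m)).
  set i := n.+1%:R^-1; set j := m.+1%:R^-1; set E := e ^+ 2.
  move=> *.
  lra.
have [p Sp xp] := Sc x (fun n => (hx n).1) xcauchy.
exists p => // s /dle ds.
rewrite -(@ler_pXn2r _ 2) ?nnegrE ?rnorm_ge0 //; apply: le_trans ds.
rewrite leNgt; apply/negP => dp.
set c := rnorm (u - p) in dp *.
have c0 : 0 < c.
  rewrite lt_def rnorm_ge0 andbT; apply/eqP => c0; move: dp.
  rewrite c0 expr0n /= ltNge => /negP; apply; apply: lb_le_inf; first by case: hA.
  by move=> _ [? _ <-]; exact: sqr_ge0.
(* If [d < c ^+ 2], a late term [y] with [f = rnorm (y - p)] gives [(c - f) ^+ 2 < d + i], hence
   [c ^+ 2 - d < i + 2 * c * f]. Taking [i] and [f] below the second entry contradicts this; the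
   first entry ensures [f < c], so that squaring is legitimate. *)
have e0 : 0 < Num.min c ((c ^+ 2 - d) / (1 + 2 * c)).
  by rewrite lt_min c0 divr_gt0 //; lra.
have [N1 hN1] := xp _ e0; have [N2 hN2] := invN _ e0.
have {hN1} := hN1 _ (leq_maxl N1 N2); have {hN2} := hN2 _ (leq_maxr N1 N2).
have [_] := hx (maxn N1 N2); set y := x _; set i := _^-1 => yd.
rewrite !lt_min => /andP[_ i2] /andP[e1 e2].
have := rnormD (u - y) (y - p).
rewrite addrA subrK -/c.
move: e1 e2 yd; set f := rnorm (y - p); set g := rnorm (u - y) => e1 e2 yd cgf.
have f0 : 0 <= f := rnorm_ge0 _.
move: i2 e2; rewrite !ltr_pdivlMr; [|lra|lra].
move=> i2 e2.
pose h := Num.max i f.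
have : h * (1 + 2 * c) < c ^+ 2 - d by rewrite /h; case: (leP i f).
have hi : i <= h by rewrite le_max lexx.
have hf : f <= h by rewrite le_max lexx orbT.
have g0 : 0 <= g := rnorm_ge0 _.
have cf : (c - f) ^+ 2 <= g ^+ 2. 
  by rewrite -subr_ge0 subr_sqr mulr_ge0; lra.
have chf : 0 <= c * (h - f) by rewrite mulr_ge0; lra.
by have := sqr_ge0 f; nra.
Qed.

Lemma orthogonal_decomposition S u : submod S -> rcomplete S ->
  exists2 p, S p & forall s, S s -> rdot (u - p) s = 0.
Proof.
move=> Ss Sc; have [p Sp pmin] := best_approximation u Ss Sc.
exists p => // s Ss'; set r := rdot _ s.
have h t : 2 * t * r <= t ^+ 2 * rnorm s ^+ 2.
  have St : S (p + t *r s) by apply: submodD => //; exact: submodZ.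
  have := pmin _ St.
  rewrite -(@ler_pXn2r _ 2) ?nnegrE ?rnorm_ge0 //.
  rewrite -!(rdotE hdot) opprD addrA.
  set y := u - p; rewrite !(rdotBl y, rdotBr _ y) !(rdotZl, rdotZr) (rdotC s y) -/r.
  by lra.
set D := rnorm s ^+ 2 in h.
have D0 : 0 <= D by exact: sqr_ge0.
(* This choice of [t] turns [h] into [2 * (D + 1) * r ^+ 2 <= D * r ^+ 2], which forces [r = 0]; the
   shift by 1 covers [s = 0]. *)
have := h (r / (D + 1)).
have -> : 2 * (r / (D + 1)) * r = (2 * (D + 1) * r ^+ 2) / (D + 1) ^+ 2.
  by field; lra.
have -> : (r / (D + 1)) ^+ 2 * D = (D * r ^+ 2) / (D + 1) ^+ 2.
  by field; lra.
rewrite ler_pM2r; last by rewrite invr_gt0 exprn_gt0 //; lra.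
have := sqr_ge0 r => r0 rD; apply/eqP; rewrite -sqrf_eq0; apply/eqP.
by apply/le_anti; rewrite r0 andbT; nra.
Qed.

(** Uniqueness behind the choice made by [xget]: for two candidates [p] and [q], the vector
    [q - p = (u - p) - (u - q)] is orthogonal to itself. *)
Lemma proj_eq S u p : S p -> (forall s, S s -> dot (u - p) (s - p) = 0) ->
  proj S u = p.
Proof.
move=> Sp up; rewrite /Defs.proj; case: xgetP => [q _ [Sq uq]|/(_ p)]; last first.
  by case; split.
have pq : rdot (u - p) (q - p) = 0 by rewrite /real_dot up // scalar_re0.
have qp : rdot (u - q) (p - q) = 0 by rewrite /real_dot uq // scalar_re0.
apply/eqP; rewrite -subr_eq0; apply/eqP/(rdot_eq0 hdot).
have {1}-> : q - p = (u - p) - (u - q) by rewrite opprB [RHS]addrC addrA subrK.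
by rewrite rdotBl pq -[q - p]opprB rdotNr qp oppr0 subrr.
Qed.

Lemma proj_submod_eq S u p : submod S -> S p ->
  (forall s, S s -> rdot (u - p) s = 0) -> proj S u = p.
Proof.
move=> Ss Sp up; apply: proj_eq => // s Ss'.
by apply: (rdot_orth Ss up); exact: submodB.
Qed.

Lemma projP S u : submod S -> rcomplete S ->
  S (proj S u) /\ forall s, S s -> rdot (u - proj S u) s = 0.
Proof.
move=> Ss Sc; have [p Sp up] := orthogonal_decomposition u Ss Sc.
by rewrite (proj_submod_eq Ss Sp up).
Qed.

Section Submodule.
Variable S : set H.
Hypotheses (Ss : submod S) (Sc : rcomplete S).

Lemma proj_in u : S (proj S u).
Proof. by have [] := projP u Ss Sc. Qed.

Lemma proj_orth u s : S s -> rdot (u - proj S u) s = 0.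
Proof. by have [_] := projP u Ss Sc; exact. Qed.

Lemma rdot_proj u s : S s -> rdot (proj S u) s = rdot u s.
Proof. by move=> /(proj_orth u); rewrite rdotBl => /eqP; rewrite subr_eq0 => /eqP. Qed.

Lemma proj_id u : S u -> proj S u = u.
Proof. by move=> Su; apply: proj_submod_eq => // s; rewrite subrr rdot0l. Qed.

Lemma projB u v : proj S (u - v) = proj S u - proj S v.
Proof.
apply: proj_submod_eq => // [|s Ss']; first by apply: submodB => //; exact: proj_in.
by rewrite !rdotBl !rdot_proj //; lra.
Qed.

Lemma projD u v : proj S (u + v) = proj S u + proj S v.
Proof.
apply: proj_submod_eq => // [|s Ss']; first by apply: submodD => //; exact: proj_in.
by rewrite rdotBl !rdotDl !rdot_proj //; lra.
Qed.

Lemma projZ a u : proj S (a *r u) = a *r proj S u.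
Proof.
apply: proj_submod_eq => // [|s Ss']; first by apply: submodZ => //; exact: proj_in.
by rewrite rdotBl !rdotZl !rdot_proj //; lra.
Qed.

Lemma rdot_proj_idem u : rdot (proj S u) u = rnorm (proj S u) ^+ 2.
Proof. by rewrite rdotC -(rdotE hdot) rdot_proj // ; exact: proj_in. Qed.

Lemma rdot_projC_idem u : rdot (u - proj S u) u = rnorm (u - proj S u) ^+ 2.
Proof.
by rewrite -(rdotE hdot) [RHS]rdotBr (proj_orth _ (proj_in u)) subr0.
Qed.

Lemma pythagoras u :
  rnorm u ^+ 2 = rnorm (proj S u) ^+ 2 + rnorm (u - proj S u) ^+ 2.
Proof.
by rewrite -rdot_projC_idem -rdot_proj_idem -(rdotE hdot) rdotBl addrC subrK.
Qed.

Lemma rnorm_proj u : rnorm (proj S u) <= rnorm u.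
Proof.
rewrite -(@ler_pXn2r _ 2) ?nnegrE ?rnorm_ge0 //.
by rewrite (pythagoras u) lerDl sqr_ge0.
Qed.

Lemma rnorm_projC u : rnorm (u - proj S u) <= rnorm u.
Proof.
rewrite -(@ler_pXn2r _ 2) ?nnegrE ?rnorm_ge0 //.
by rewrite (pythagoras u) lerDr sqr_ge0.
Qed.

Lemma proj_orthC u : proj (orth dot S) u = u - proj S u.
Proof.
apply: proj_submod_eq; first exact: orth_submod.
  by apply: rdot_orth => // s; exact: proj_orth.
move=> s so; rewrite opprB addrC subrK rdotC; apply: orth_rdot so _.
exact: proj_in.
Qed.

Lemma proj_affine w u : proj [set w + v | v in S] u = w + proj S (u - w).
Proof.
apply: proj_eq => [|_ [v Sv <-]]; first by exists (proj S (u - w)) => //; exact: proj_in.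
rewrite opprD !addrA (addrC w) addrK.
by apply: (rdot_orth Ss (proj_orth (u - w))); apply: submodB => //; exact: proj_in.
Qed.

End Submodule.
End Projection.

(** * Friedrichs angle and closedness of the sum *)

Section Angles.
Context {R : realType} {k : scalar_kind}
  {H : completeNormedModType (scalar_field R k)}
  {dot : {dot H for @scalar_conj R k}}.
Hypothesis hdot : hilbert_norm dot.
Implicit Types (u v w p s : H) (a b : R) (z : scalar_field R k) (S : set H).

Local Notation "a *r u" := (scalar_of_real k a *: u) (at level 40).
Local Notation rdot := (@real_dot _ _ _ dot).
Local Notation proj := (proj dot).

Variables U V : set H.
Hypotheses (Us : submod U) (Uc : rcomplete U) (Vs : submod V) (Vc : rcomplete V).

Local Notation U0 := (friedrichs_part dot U V).

Lemma friedrichs_part_submod : submod U0.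
Proof. by apply: submodI => //; exact: orth_submod. Qed.

Lemma friedrichs_part_rcomplete : rcomplete U0.
Proof. exact: rcompleteI_orth. Qed.

(** The residual [q = u - proj V u] is fixed by the projection onto the complement of [V], so
    [rnorm q ^+ 2] is the inner product of [u] with the image of [q] under the composed projections.
    Bounding that image by the operator norm and dividing by [rnorm q] gives the estimate. *)
Lemma sin_theta_p : let s := sin (theta_p dot U V) in
  0 <= s /\ forall u, U u -> rnorm (u - proj V u) <= s * rnorm u.
Proof.
rewrite /theta_p /opnorm; set A := image _ _.
have fE v : (proj U \o proj (orth dot V)) v = proj U (v - proj V v).
  by rewrite /= proj_orthC.
have A1 : ubound A 1.
  move=> _ [v v1 <-]; rewrite fE; apply: le_trans v1.
  by apply: (le_trans (rnorm_proj hdot Us Uc _)); exact: rnorm_projC.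
have bA : has_ubound A by exists 1.
have A0 : A 0.
  exists 0; first by rewrite /= rnorm0 ler01.
  rewrite fE; apply/eqP; rewrite -sqrf_eq0 -(rdotE hdot).
  by rewrite -(subrr 0) !projB // !subrr rdot0l.
have s0 : 0 <= sup A by exact: ub_le_sup.
have s1 : sup A <= 1 by apply: ge_sup => //; exists 0.
(* The operator norm lies in [0, 1], so it really is the sine of [theta_p]. *)
rewrite asinK ?in_itv /= ?s1 ?andbT; last by lra.
split=> // u Uu; set q := u - proj V u.
have opA v : rnorm (proj U (v - proj V v)) <= sup A * rnorm v.
  have [v0|v0] := eqVneq (rnorm v) 0.
    rewrite v0 mulr0 -v0; apply: (le_trans (rnorm_proj hdot Us Uc _)).
    exact: rnorm_projC.
  have {}v0 : 0 < rnorm v by rewrite lt_def v0 rnorm_ge0.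
  rewrite -ler_pdivrMr //; apply: ub_le_sup => //.
  exists ((rnorm v)^-1 *r v).
    by rewrite /= rnormZ modulus_real ger0_norm ?invr_ge0 ?rnorm_ge0 // mulVf // gt_eqF.
  rewrite fE projZ // -scalerBr projZ // rnormZ modulus_real.
  rewrite ger0_norm ?invr_ge0 ?rnorm_ge0 //.
  by rewrite mulrC.
have [->|q0] := eqVneq (rnorm q) 0; first by rewrite mulr_ge0 ?rnorm_ge0.
have {}q0 : 0 < rnorm q by rewrite lt_def q0 rnorm_ge0.
have qq : rnorm q ^+ 2 = rdot (proj U (q - proj V q)) u.
  have -> : proj V q = 0 by rewrite projB // (proj_id hdot Vs (proj_in hdot Vs Vc u)) subrr.
  by rewrite subr0 rdot_proj // -rdot_projC_idem.
rewrite -(ler_pM2r q0) -expr2 qq; apply: (le_trans (cauchy_schwarz hdot _ _)).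
by rewrite mulrAC; apply: ler_wpM2r; [exact: rnorm_ge0|exact: opA].
Qed.

Hypothesis htheta : 0 < theta_f dot U V.

(** For [u] in [U0], [proj V u] lies in the Friedrichs part of [V], so the cosine [c] of the angle
    bounds the inner product of the two: [rnorm (proj V u) <= c * rnorm u]. Pythagoras converts this
    into the lower bound on the residual. *)
Lemma sin_theta_f : let s := sin (theta_f dot U V) in
  0 < s /\ forall u, U0 u -> s ^+ 2 * rnorm u ^+ 2 <= rnorm (u - proj V u) ^+ 2.
Proof.
move: htheta; rewrite /theta_f; set A := [set c | _].
have A1 : ubound A 1.
  by move=> _ [u [v [_ _ u1 v1 ->]]];
    have := modulus_dot_le hdot u v; rewrite u1 v1 mulr1.
have bA : has_ubound A by exists 1.
have [c0 c1] : 0 <= sup A /\ sup A <= 1.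
  have [A0|/set0P [a Aa]] := eqVneq A set0; first by rewrite A0 sup0.
  split; last by apply: ge_sup => //; exists a.
  apply: le_trans (ub_le_sup bA Aa); case: Aa => [u [v [_ _ _ _ ->]]].
  exact: modulus_ge0.
(* Here the positivity of the angle enters: [sup A = 1] would give [acos 1 = 0]. *)
move=> t0; have {}c1 : sup A < 1.
  by rewrite lt_neqAle c1 andbT; apply: contraTneq t0 => ->; rewrite acos1 ltxx.
set c := sup A in c0 c1 *.
rewrite sin_acos; last by lra.
have c2 : 0 < 1 - c ^+ 2 by nra.
split; first by rewrite sqrtr_gt0.
move=> u U0u; rewrite sqr_sqrtr ?(ltW c2) //.
have puV : friedrichs_part dot V U (proj V u).
  split; first exact: proj_in.
  rewrite setIC; apply: rdot_orth; first exact: submodI.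
  by move=> s [Us' Vs']; rewrite rdot_proj //; apply: orth_rdot U0u.2 _.
have key : rnorm (proj V u) ^+ 2 <= c * rnorm u * rnorm (proj V u).
  have [u0|u0] := eqVneq (rnorm u) 0.
    rewrite u0 mulr0 mul0r; have := rnorm_proj hdot Vs Vc u.
    by rewrite u0; have := rnorm_ge0 (proj V u); nra.
  have [p0|p0] := eqVneq (rnorm (proj V u)) 0; first by rewrite p0 expr0n mulr0.
  have {}u0 : 0 < rnorm u by rewrite lt_def u0 rnorm_ge0.
  have {}p0 : 0 < rnorm (proj V u) by rewrite lt_def p0 rnorm_ge0.
  have : rdot ((rnorm u)^-1 *r u) ((rnorm (proj V u))^-1 *r proj V u) <= c.
    apply: (le_trans (scalar_re_modulus _)); apply: ub_le_sup => //.
    exists ((rnorm u)^-1 *r u), ((rnorm (proj V u))^-1 *r proj V u).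
    split=> //.
    - exact: submodZ friedrichs_part_submod _.
    - by apply: submodZ => //; apply: submodI => //; exact: orth_submod.
    - by rewrite rnormZ modulus_real ger0_norm ?invr_ge0 ?rnorm_ge0 // mulVf // gt_eqF.
    - by rewrite rnormZ modulus_real ger0_norm ?invr_ge0 ?rnorm_ge0 // mulVf // gt_eqF.
  rewrite rdotZl rdotZr (rdotC u) rdot_proj_idem // mulrA -invfM mulrC.
  by rewrite ler_pdivrMr ?mulr_gt0 // mulrA.
have {}key : rnorm (proj V u) <= c * rnorm u.
  have [->|p0] := eqVneq (rnorm (proj V u)) 0; first by rewrite mulr_ge0 ?rnorm_ge0.
  by rewrite -(@ler_pM2r _ (rnorm (proj V u))) -?expr2 // lt_def p0 rnorm_ge0.
have {}key : rnorm (proj V u) ^+ 2 <= (c * rnorm u) ^+ 2.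
  by rewrite ler_pXn2r ?nnegrE ?mulr_ge0 ?rnorm_ge0.
by have := pythagoras hdot Vs Vc u; move: key; rewrite exprMn; lra.
Qed.

(** Residuals modulo [V] control [U0]-components from below, so a Cauchy sequence of sums has Cauchy
    components, whose limits add up to its limit. *)
Lemma sum_rcomplete : rcomplete [set u + v | u in U0 & v in V].
Proof.
have [s0 sU] := sin_theta_f; set s := sin _ in s0 sU.
move=> x xS xc.
have /choice[a ha] n : exists u, U0 u /\ V (x n - u).
  by have [u U0u [v Vv <-]] := xS n; exists u; rewrite addrC addKr.
have ac : rcauchy a.
  move=> e e0; have [|N hN] := xc (s * e); first exact: mulr_gt0.
  exists N => m n Nm Nn; have {hN} := hN m n Nm Nn; set y := x m - x n => ys.
  have [Uam Vam] := ha m; have [Uan Van] := ha n.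
  have Uy : U0 (a m - a n) by apply: submodB => //; exact: friedrichs_part_submod.
  have Vy : V (y - (a m - a n)).
    rewrite /y subrACA.
    exact: submodB.
  (* Vectors differing by an element of [V] have the same residual. *)
  have Qy : y - proj V y = (a m - a n) - proj V (a m - a n).
    have -> : proj V y = y - (a m - a n) + proj V (a m - a n).
      by rewrite -[in LHS](subrK (a m - a n) y) (projD hdot Vs Vc (y - _)) //
        (proj_id hdot Vs Vy).
    by rewrite opprD addrA (opprB y) addrCA subrr addr0.
  have := sU _ Uy; rewrite -Qy => sy.
  rewrite -(ltr_pM2l s0); apply: le_lt_trans ys.
  rewrite -(@ler_pXn2r _ 2) ?nnegrE ?mulr_ge0 ?rnorm_ge0 ?(ltW s0) //.
  rewrite exprMn; apply: (le_trans sy).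
  by rewrite ler_pXn2r ?nnegrE ?rnorm_ge0 // rnorm_projC.
have [l Ul al] := friedrichs_part_rcomplete (fun n => (ha n).1) ac.
have [l' Vl xl] := Vc (fun n => (ha n).2) (rcauchyB xc ac).
exists (l + l'); first by exists l => //; exists l'.
have := rcvgD al xl; congr rcvg; apply: funext => n.
by rewrite addrC subrK.
Qed.

Lemma sum_submod : submod [set u + v | u in U0 & v in V].
Proof.
have [U00 U0l] := friedrichs_part_submod; have [V0 Vl] := Vs.
split; first by exists 0 => //; exists 0 => //; rewrite addr0.
move=> z _ _ [u Uu [v Vv <-]] [u' Uu' [v' Vv' <-]].
exists (z *: u + u'); first exact: U0l.
by exists (z *: v + v'); [exact: Vl|rewrite scalerDr addrACA].
Qed.

Lemma orth_decomposition w : exists m v r,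
  [/\ U m, V v, w = m + v + r,
      forall s, U s -> rdot r s = 0 & forall s, V s -> rdot r s = 0].
Proof.
have [p [m Um [v Vv <-]] rp] := orthogonal_decomposition hdot w sum_submod sum_rcomplete.
exists m, v, (w - (m + v)).
have rV s : V s -> rdot (w - (m + v)) s = 0.
  move=> Vs'; apply: rp; exists 0; first by have [] := friedrichs_part_submod.
  by exists s => //; rewrite add0r.
split=> //; first exact: Um.1; first by rewrite addrC subrK.
move=> s Us'; have UVs : submod (U `&` V) by exact: submodI.
have UVc : rcomplete (U `&` V) by exact: rcompleteI.
have [Ps Ps'] := proj_in hdot UVs UVc s.
(* All of [U] is contained in [U0 + V]: subtracting the projection onto the intersection leaves an
   element of [U0]. *)
apply: rp; exists (s - proj (U `&` V) s); last first.
  by exists (proj (U `&` V) s) => //; rewrite subrK.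
split; first exact: submodB.
by apply: rdot_orth => // t; exact: proj_orth.
Qed.

End Angles.

(** * The error operator *)

Section Richardson.
Context {R : realType} {k : scalar_kind}
  {H : completeNormedModType (scalar_field R k)}
  {dot : {dot H for @scalar_conj R k}}.
Hypothesis hdot : hilbert_norm dot.
Implicit Types (u v w p s : H) (a b : R) (z : scalar_field R k) (S : set H).

Local Notation "a *r u" := (scalar_of_real k a *: u) (at level 40).
Local Notation rdot := (@real_dot _ _ _ dot).
Local Notation proj := (proj dot).

(* Polarization turns the bound on the quadratic form into a bound on
   [rdot (B u) v], which is then tested against the multiple of [B u] of norm
   [rnorm u]. *)
Lemma selfadjoint_bound S (B : H -> H) q : submod S ->
  (forall u, S u -> S (B u)) -> {morph B : u v / u + v} ->
  {morph B : u v / u - v} ->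
  (forall u v, S u -> S v -> rdot (B u) v = rdot u (B v)) ->
  (forall u, S u -> `|rdot (B u) u| <= q * rnorm u ^+ 2) ->
  forall u, S u -> rnorm (B u) <= q * rnorm u.
Proof.
move=> Ss SB BD BB Bsym Bq u Su.
have [u0|u0] := eqVneq (rnorm u) 0.
  by rewrite (rnorm_eq0 u0) -[X in B X](subrr 0) BB subrr rnorm0 mulr0.
have {}u0 : 0 < rnorm u by rewrite lt_def u0 rnorm_ge0.
rewrite -(ler_pM2r u0) -mulrA -expr2.
have [->|b0] := eqVneq (rnorm (B u)) 0.
  by rewrite mul0r; apply: le_trans (Bq _ Su).
have {}b0 : 0 < rnorm (B u) by rewrite lt_def b0 rnorm_ge0.
pose t := rnorm u / rnorm (B u); pose v := t *r B u.
have Sv : S v by apply: submodZ => //; exact: SB.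
(* The upper bound at [u + v] plus the lower bound at [u - v] leaves four times [rdot (B u) v],
   against [4 * q * rnorm u ^+ 2] since both vectors have the same norm. *)
have := Bq _ (submodD Ss Su Sv); have := Bq _ (submodB Ss Su Sv).
rewrite !ler_norml => /andP[+ _] /andP[_ +].
rewrite BB BD -!(rdotE hdot) !(rdotBl, rdotBr, rdotDl, rdotDr).
rewrite (Bsym v u) // (rdotC v (B u)) (rdotC v u).
have -> : rdot (B u) v = rnorm u * rnorm (B u).
  by rewrite rdotZr rdotE // /t expr2 mulrA divfK ?gt_eqF.
have -> : rdot v v = rdot u u.
  rewrite rdotZl rdotZr !rdotE // mulrA -expr2 -exprMn /t divfK ?gt_eqF //.
rewrite rdotE //.
move: (rdot (B u) u) (rdot (B v) v) (rdot u v) => x y d h1 h2.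
by nra.
Qed.

Variables U V : set H.
Hypotheses (Us : submod U) (Uc : rcomplete U) (Vs : submod V) (Vc : rcomplete V).

Local Notation U0 := (friedrichs_part dot U V).

(** One Richardson step with parameter [a] for the equation [T e = 0]. *)
Definition richardson a u := u - a *r proj U (u - proj V u).

Lemma richardson_friedrichs a u : U0 u -> U0 (richardson a u).
Proof.
move=> U0u; apply: submodB => //; first exact: friedrichs_part_submod.
apply: submodZ; first exact: friedrichs_part_submod.
split; first exact: proj_in.
apply: rdot_orth => [|s [Us' Vs']]; first exact: submodI.
by rewrite rdot_proj // proj_orth.
Qed.

Lemma richardsonB a : {morph richardson a : u v / u - v}.
Proof.
move=> u v; rewrite /richardson (projB hdot Vs Vc) (subrACA u v (proj V u)).
by rewrite (projB hdot Us Uc (u - _)) scalerBr subrACA.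
Qed.

Lemma richardsonD a : {morph richardson a : u v / u + v}.
Proof.
move=> u v; have B0 : richardson a 0 = 0 by have := richardsonB a 0 0; rewrite !subrr.
have BN : richardson a (- v) = - richardson a v.
  by rewrite -[- v]sub0r richardsonB B0 sub0r.
by rewrite -[in LHS](opprK v) richardsonB BN opprK.
Qed.

(** This form is symmetric in [u] and [v], which yields both self-adjointness on [U0] and the
    quadratic form. *)
Lemma rdot_richardson a u v : U v ->
  rdot (richardson a u) v = rdot u v - a * rdot (u - proj V u) (v - proj V v).
Proof.
move=> Uv; rewrite /richardson (rdotBl u) rdotZl rdot_proj // [in RHS]rdotBr.
by rewrite (proj_orth hdot Vs Vc u (proj_in hdot Vs Vc v)) subr0.
Qed.

Lemma richardson_contraction sf sp a e : 0 < sf -> 0 < sp -> sf <= sp ->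
  (forall u, U0 u -> sf ^+ 2 * rnorm u ^+ 2 <= rnorm (u - proj V u) ^+ 2) ->
  (forall u, U u -> rnorm (u - proj V u) <= sp * rnorm u) ->
  let l := sp ^+ 2 / 2 * a in 0 <= l <= 1 -> U0 e ->
  rnorm (richardson a e) <=
    (1 - 2 * Num.min l (1 - l) / (sp / sf) ^+ 2) * rnorm e.
Proof.
move=> sf0 sp0 sfp lo hi l /andP[l0 l1].
set mu := Num.min _ _; set q := 1 - _ => U0e.
have mul : mu <= l by rewrite ge_min lexx.
have mul' : mu <= 1 - l by rewrite ge_min lexx orbT.
have mu0 : 0 <= mu by rewrite le_min l0 subr_ge0.
have a0 : 0 <= a.
  by move: l0; rewrite /l mulrC pmulr_lge0 //; nra.
pose r := (sp / sf) ^-2.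
have r0 : 0 < r by rewrite invr_gt0 exprn_gt0 // divr_gt0.
have r1 : r <= 1.
  rewrite /r exprMn invfM exprVn invrK mulrC ler_pdivrMr ?exprn_gt0 // mul1r.
  by rewrite ler_pXn2r ?nnegrE // ltW.
have rl : 2 * l * r = a * sf ^+ 2.
  by rewrite /l /r; field; rewrite !gt_eqF.
have sl : a * sp ^+ 2 = 2 * l by rewrite /l; field.
have qE : q = 1 - 2 * mu * r by [].
have := @selfadjoint_bound U0 (richardson a) q; apply=> //.
- exact: friedrichs_part_submod.
- exact: richardson_friedrichs.
- exact: richardsonD.
- exact: richardsonB.
- move=> u v [Uu _] [Uv _]; rewrite (rdotC u) !rdot_richardson //.
  by rewrite (rdotC v u) (rdotC (v - _)).
move=> u U0u; have lou := lo u U0u; have hiu := hi u U0u.1.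
have {}hiu : rnorm (u - proj V u) ^+ 2 <= sp ^+ 2 * rnorm u ^+ 2.
  by rewrite -exprMn ler_pXn2r ?nnegrE ?mulr_ge0 ?rnorm_ge0 // ltW.
rewrite rdot_richardson ?(rdotE hdot); last by case: U0u.
have : 0 <= rnorm u ^+ 2 by exact: sqr_ge0.
move: (rnorm (u - _) ^+ 2) (rnorm u ^+ 2) lou hiu => X Y lou hiu Y0.
have h1 : a * (sf ^+ 2 * Y) <= a * X by exact: ler_wpM2l.
have h2 : a * X <= a * (sp ^+ 2 * Y) by exact: ler_wpM2l.
rewrite mulrA -rl in h1; rewrite mulrA sl in h2.
(* The form [Y - a * X] lies between [(1 - 2 * l) * Y] and [(1 - 2 * l * r) * Y]. The upper end is
   controlled by [mu <= l], the lower one by [mu <= 1 - l] and [r <= 1]. *)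
have h3 : mu * r * Y <= l * r * Y by rewrite !ler_wpM2r // ltW.
have h4 : mu * r * Y <= mu * Y by rewrite ler_wpM2r // ler_piMr.
have h5 : mu * Y <= (1 - l) * Y by rewrite ler_wpM2r.
rewrite qE ler_norml; apply/andP; split; nra.
Qed.

End Richardson.

(** * Decay rates and minimal gaps *)

(** The lower limit is the supremum of the tail infima, so some tail has a positive infimum; it is
    finite, being below a real term. *)
Lemma limn_einf_gt0 (R : realType) (x : nat -> R) :
  (0 < limn_einf (fun n => (x n)%:E))%E ->
  exists d N, 0 < d /\ forall n, (N <= n)%N -> d <= x n.
Proof.
rewrite limn_einf_lim (cvg_lim _ (@cvg_einfs_sup _ _)) //.
move=> /ereal_sup_gt[_ [N _ <-]] N0.
have le n : (N <= n)%N -> (einfs (fun n => (x n)%:E) N <= (x n)%:E)%E.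
  by move=> Nn; apply: ereal_inf_lbound; exists n.
have fin : einfs (fun n => (x n)%:E) N \is a fin_num.
  by rewrite gt0_fin_numE // (le_lt_trans (le N (leqnn N))) ?ltry.
exists (fine (einfs (fun n => (x n)%:E) N)), N; split.
  by rewrite -lte_fin fineK.
by move=> n /le; rewrite -{1}(fineK fin) lee_fin.
Qed.

Lemma contraction_mean_decay (R : realType) (c : R) (mu x : nat -> R) :
  0 < c -> (forall n, 0 <= mu n) -> (forall n, 0 <= x n) ->
  (forall n, x n.+1 <= (1 - c * mu n) * x n) ->
  (0 < limn_einf (fun n => (n%:R^-1 * \sum_(0 <= j < n) mu j)%:E))%E ->
  exists C q, [/\ 0 <= C, 0 < q < 1 & forall n, x n <= C * q ^+ n].
Proof.
move=> c0 mu0 x0 xS /limn_einf_gt0[d [N [d0 dN]]].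
have xe n : x n <= expR (- c * \sum_(0 <= j < n) mu j) * x 0%N.
  elim: n => [|n IH]; first by rewrite big_nil mulr0 expR0 mul1r.
  apply: (le_trans (xS n)); rewrite big_nat_recr //= mulrDr [- c * _ + _]addrC expRD -mulrA.
  (* The factor is replaced by its exponential first, so that the induction hypothesis is multiplied
     by something nonnegative. *)
  apply: (@le_trans _ _ (expR (- c * mu n) * x n)).
    by apply: ler_wpM2r => //; rewrite mulNr expR_ge1Dx.
  by apply: ler_wpM2l => //; exact: expR_ge0.
pose q := expR (- (c * d)).
have q0 : 0 < q by exact: expR_gt0.
have q1 : q < 1 by rewrite expR_lt1 oppr_lt0 mulr_gt0.
(* The averages are bounded below only from [N] on; dividing by [q ^+ N] absorbs the earlier terms,
   which are at most [x 0]. *)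
exists (x 0%N / q ^+ N), q; split; first by rewrite divr_ge0 ?exprn_ge0 // ltW.
  by rewrite q0.
move=> n; have [Nn|nN] := leqP N n.
  apply: (@le_trans _ _ (x 0%N * q ^+ n)).
    apply: (le_trans (xe n)); rewrite mulrC ler_wpM2l // -expRM_natl ler_expR.
    (* At [n = 0] both exponents vanish; clearing the denominator of the average requires a positive
       [n]. *)
    case: n Nn => [|n] Nn; first by rewrite big_nil mulr0 mul0r.
    have := dN _ Nn; rewrite mulrC ler_pdivlMr ?ltr0Sn // => h.
    rewrite mulrN mulNr lerN2 mulrCA; apply: ler_wpM2l; first exact: ltW.
    by rewrite mulrC.
  rewrite ler_wpM2r ?exprn_ge0 ?(ltW q0) // ler_peMr // invf_ge1 ?exprn_gt0 //.
  by rewrite exprn_ile1 ?ltW.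
apply: (@le_trans _ _ (x 0%N)).
  apply: (le_trans (xe n)); rewrite ler_piMl // -expR0 ler_expR mulNr oppr_le0.
  by rewrite mulr_ge0 ?sumr_ge0 // ltW.
rewrite -mulrA ler_peMr // mulrC ler_pdivlMr ?exprn_gt0 // mul1r.
by rewrite ler_wiXn2l ?(ltW q0) ?(ltW q1) ?(ltnW nN).
Qed.

(** * Residuals with respect to [W] and the minimal gap set *)

Section Residual.
Context {R : realType} {k : scalar_kind}
  {H : completeNormedModType (scalar_field R k)}
  {dot : {dot H for @scalar_conj R k}}.
Hypothesis hdot : hilbert_norm dot.
Local Notation rdot := (@real_dot _ _ _ dot).
Local Notation proj := (proj dot).
Variables (U V : set H) (w m v r : H).
Hypotheses (Us : submod U) (Uc : rcomplete U) (Vs : submod V) (Vc : rcomplete V).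
Hypotheses (Um : U m) (Vv : V v) (wE : w = m + v + r).
Hypotheses (rU : forall s, U s -> rdot r s = 0) (rV : forall s, V s -> rdot r s = 0).

Local Notation W := [set w + s | s in V].

(** The component [v] of [w] is absorbed by [V] and [proj V] kills [r], so relative to [m] only the
    constant offset [r] remains. *)
Lemma affine_residual u :
  u - proj W u = (u - m) - proj V (u - m) - r.
Proof.
rewrite proj_affine //; have -> : u - w = u - m - (v + r).
  by rewrite wE -(addrA m) opprD addrA.
rewrite (projB hdot Vs Vc (u - m)) (projD hdot Vs Vc v) (proj_id hdot Vs Vv).
have -> : proj V r = 0.
  by apply: proj_submod_eq => // [|s Vs']; [have [] := Vs|rewrite subr0 rV].
rewrite addr0 wE -(addrA m) (addrC v) addrA -(addrA (m + r)).
by rewrite (addrCA v) subrr addr0 (addrAC m) !opprD !addrA.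
Qed.

Lemma residual_sqr u : U u -> rnorm (u - proj W u) ^+ 2 =
  rnorm (u - m - proj V (u - m)) ^+ 2 + rnorm r ^+ 2.
Proof.
move=> Uu; rewrite affine_residual -!(rdotE hdot).
set y := _ - proj V _; have yr : rdot r y = 0.
  rewrite rdotBr rU ?rV ?subr0 //; [exact: proj_in|exact: submodB].
by rewrite (rdotBl y) !(rdotBr _ y) (rdotC y) yr; lra.
Qed.

(** By [residual_sqr] the gap is at least [rnorm r], with equality exactly when [u - m] has zero
    residual modulo [V], that is, lies in [V]. *)
Lemma min_gap_setE :
  min_gap_set dot U W = [set m + s | s in U `&` V].
Proof.
have gm : rnorm (m - proj W m) = rnorm r.
  have p0 : proj V 0 = 0 by apply: proj_id => //; have [] := Vs.
  by rewrite affine_residual !subrr p0 subrr sub0r rnormN.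
set A := [set rnorm (x - proj W x) | x in U].
have lbA : lbound A (rnorm r).
  move=> _ [x Ux <-]; rewrite -(@ler_pXn2r _ 2) ?nnegrE ?rnorm_ge0 //.
  by rewrite residual_sqr // lerDr sqr_ge0.
have infA : inf A = rnorm r.
  apply/le_anti; rewrite lb_le_inf ?andbT //; last by exists (rnorm r), m.
  by apply: ge_inf; [exists (rnorm r)|exists m].
apply/seteqP; split=> [x [Ux]|_ [s [Us' Vs'] <-]]; rewrite -/A.
  rewrite infA => xr; exists (x - m); last by rewrite addrC subrK.
  split; first exact: submodB.
  have := residual_sqr Ux; rewrite xr => /eqP; rewrite -subr_eq0 opprD addrCA subrr addr0.
  rewrite oppr_eq0 sqrf_eq0 => /eqP/rnorm_eq0/eqP; rewrite subr_eq0 => /eqP ->.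
  exact: proj_in.
split; first exact: submodD.
rewrite -/A infA affine_residual (addrC m) addrK (proj_id hdot Vs Vs') subrr.
by rewrite sub0r rnormN.
Qed.

(** Projecting onto [U] removes the offset [r], and [p - m] lies in [V], so [u - m] and [u - p] have
    the same residual. *)
Lemma relaxed_step a u p : U u -> min_gap_set dot U W p ->
  proj U (relaxed_proj dot W a u) - p = richardson (dot := dot) U V a (u - p).
Proof.
move=> Uu; rewrite min_gap_setE => -[s [Us' Vs'] <-].
have Ux : U (m + s) by exact: submodD.
rewrite /relaxed_proj -(opprB u) affine_residual scalerN (projB hdot Us Uc u).
rewrite (proj_id hdot Us Uu) projZ // (projB hdot Us Uc _ r).
have -> : proj U r = 0.
  by apply: proj_submod_eq => // [|t Ut]; [have [] := Us|rewrite subr0 rU].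
rewrite subr0 /richardson opprD !addrA.
have -> : u - m - s - proj V (u - m - s) = u - m - proj V (u - m).
  rewrite (projB hdot Vs Vc (u - m)) (proj_id hdot Vs Vs').
  by rewrite opprB addrA subrK.
by rewrite [RHS]addrAC; congr (_ - s); rewrite addrAC.
Qed.

Lemma initial_error u : U u ->
  friedrichs_part dot U V (u - proj (min_gap_set dot U W) u) /\
  min_gap_set dot U W (proj (min_gap_set dot U W) u).
Proof.
move=> Uu; rewrite min_gap_setE.
have UVs : submod (U `&` V) by exact: submodI.
have UVc : rcomplete (U `&` V) by exact: rcompleteI.
rewrite proj_affine //; have [Ps Ps'] := proj_in hdot UVs UVc (u - m).
split; last by exists (proj (U `&` V) (u - m)).
rewrite opprD addrA; split; first by apply: submodB => //; exact: submodB.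
by apply: rdot_orth => // t; exact: proj_orth.
Qed.

End Residual.

Theorem proposition5p2 (R : realType) (k : scalar_kind)
    (H : completeNormedModType (scalar_field R k)) (dot : {dot H for @scalar_conj R k})
    (hdot : hilbert_norm dot)
    (U V W : set H) (hU : closed_subspace U) (hW : closed_affine_subspace W V)
    (htheta : 0 < theta_f dot U V)
    (alpha : nat -> R) (u : nat -> H)
    (hu0 : U (u 0%N))
    (hu : forall n, u n.+1 = proj dot U (relaxed_proj dot W (alpha n) (u n))) :
  let e := fun n => u n - proj dot (min_gap_set dot U W) (u 0%N) in
  let lambda := fun n => sin (theta_p dot U V) ^+ 2 / 2 * alpha n in
  let kappa := sin (theta_p dot U V) / sin (theta_f dot U V) in
  ((forall n, 0 <= lambda n <= 1) ->
   (0 < limn_einf (fun n =>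
      (n%:R^-1 * \sum_(0 <= j < n) Num.min (lambda j) (1 - lambda j))%:E))%E ->
   converges_linearly_to_zero e) /\
  (forall eps : R, 0 < eps <= 1 ->
   (forall n, eps / 2 <= lambda n <= 1 - eps / 2) ->
   forall n, rnorm (e n) <= (1 - eps / kappa ^+ 2) ^+ n * rnorm (e 0%N)).
Proof.
move=> e lambda kappa.
have [Ucl /submodP Us] := hU; have Uc := closed_rcomplete Ucl.
have [Wc /submodP Vs [w wE]] := hW.
have Vc : rcomplete V by apply: (@rcomplete_affine _ _ _ w); rewrite -wE.
have [m [v [r [Um Vv wd rU rV]]]] := orth_decomposition hdot Us Uc Vs Vc htheta w.
have [sp0 hsp] := sin_theta_p hdot Us Uc Vs Vc.
have [sf0 hsf] := sin_theta_f hdot Us Vs Vc htheta.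
set sp := sin (theta_p _ _ _) in sp0 hsp lambda kappa *.
set sf := sin (theta_f _ _ _) in sf0 hsf kappa *.
have [e0U pM] := initial_error hdot Us Uc Vs Vc Um Vv wd rU rV hu0.
rewrite -wE in e0U pM.
have uU n : U (u n) by case: n => // n; rewrite hu; exact: proj_in.
have eS n : e n.+1 = richardson (dot := dot) U V (alpha n) (e n).
  rewrite /e hu wE; apply: (relaxed_step hdot Us Uc Vs Vc Um Vv wd rU rV) => //.
  by rewrite -wE.
have eU n : friedrichs_part dot U V (e n).
  by elim: n => [|i IH]; rewrite ?eS; [exact: e0U|exact: richardson_friedrichs].
(* A zero initial error stays zero. This case is separate because [sf <= sp] can fail when [U0] is
   trivial, for instance when [U] lies in [V]. *)
have [e00|e00] := eqVneq (rnorm (e 0%N)) 0.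
  have en n : rnorm (e n) = 0.
    elim: n => // i /rnorm_eq0 IH; rewrite eS IH.
    by rewrite -(subrr 0) richardsonB // subrr rnorm0.
  split=> [_ _|eps _ _ n]; last by rewrite !en mulr0.
  by exists 0, 2^-1; split=> [//||n]; [lra|rewrite en mul0r].
have {}e00 : 0 < rnorm (e 0%N) by rewrite lt_def e00 rnorm_ge0.
(* The nonzero vector [e 0] of [U0] compares the sines: its residual lies between [sf] and [sp]
   times its norm. *)
have sfp : sf <= sp.
  rewrite -(ler_pM2r e00); apply: le_trans (hsp _ (eU 0%N).1).
  rewrite -(@ler_pXn2r _ 2) ?nnegrE ?mulr_ge0 ?rnorm_ge0 ?(ltW sf0) // exprMn.
  exact: hsf.
have {}sp0 : 0 < sp by exact: lt_le_trans sfp.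
have kappa0 : 0 < kappa ^+ 2 by rewrite exprn_gt0 // divr_gt0.
have step n : 0 <= lambda n <= 1 -> rnorm (e n.+1) <=
    (1 - 2 * Num.min (lambda n) (1 - lambda n) / kappa ^+ 2) * rnorm (e n).
  by move=> ln; rewrite eS; exact: richardson_contraction.
split=> [l01 lpos|eps /andP[eps0 eps1] leps].
  have [||n|n||C [q [C0 q01 hC]]] := @contraction_mean_decay _ (2 / kappa ^+ 2)
    (fun n => Num.min (lambda n) (1 - lambda n)) (fun n => rnorm (e n)).
  - by rewrite divr_gt0.
  - by move=> n; have := l01 n; rewrite le_min subr_ge0.
  - exact: rnorm_ge0.
  - by rewrite mulrAC; exact: step.
  - exact: lpos.
  by exists C, q.
have kappa1 : 1 <= kappa ^+ 2 by rewrite exprn_ege1 // ler_pdivlMr // mul1r.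
elim=> [|n IH]; first by rewrite expr0 mul1r.
have ln : 0 <= lambda n <= 1 by have := leps n; lra.
apply: (le_trans (step n ln)); rewrite [_ ^+ n.+1]exprS -[leRHS]mulrA.
apply: (@le_trans _ _ ((1 - eps / kappa ^+ 2) * rnorm (e n))).
  apply: ler_wpM2r; first exact: rnorm_ge0.
  have mu2 : eps / 2 <= Num.min (lambda n) (1 - lambda n).
    by rewrite le_min; have := leps n; lra.
  have k0 : 0 <= (kappa ^+ 2)^-1 by rewrite invr_ge0 ltW.
  have := ler_wpM2r k0 mu2; move: (kappa ^+ 2)^-1 (Num.min _ _) => i mu.
  by lra.
(* The rate is nonnegative because [eps <= 1 <= kappa ^+ 2], so it may multiply the induction
   hypothesis. *)
apply: ler_wpM2l => //; rewrite subr_ge0 ler_pdivrMr // mul1r.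
exact: le_trans kappa1.
Qed.
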